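(* Let $\mathbb{G}$ be a locally compact group. Then $\mathbb{G}$ is discrete if and only if the forgetful functor from the category of compact Hausdorff spaces equipped with a continuous $\mathbb{G}$-action to the category of compact Hausdorff spaces creates coproducts.
   Context: A continuous $\mathbb{G}$-action on a space $X$ is an action for which $\mathbb{G}\times X\to X$ is (jointly) continuous; morphisms between spaces carrying $\mathbb{G}$-actions are the continuous $\mathbb{G}$-equivariant maps. A functor $F:\mathcal{A}\to\mathcal{B}$ creates coproducts if for every set-indexed family $(A_i)_{i\in I}$ of objects of $\mathcal{A}$ and every coproduct $(F(A_i)\xrightarrow{\iota_i}B)_{i\in I}$ in $\mathcal{B}$ there is a unique family of morphisms $(A_i\xrightarrow{j_i}A)_{i\in I}$ in $\mathcal{A}$ with $F(A)=B$ and $F(j_i)=\iota_i$ for all $i$, and moreover this family is a coproduct of $(A_i)_{i\in I}$ in $\mathcal{A}$. *)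

(* Defs.v *)
From HB Require Import structures.
From mathcomp Require Import all_boot all_classical topology.

Set Implicit Arguments.
Unset Strict Implicit.
Unset Printing Implicit Defensive.

Local Open Scope classical_set_scope.

Record category := Category {
  obj :> Type;
  hom : obj -> obj -> Type;
  idc : forall A, hom A A;
  compc : forall A B C, hom B C -> hom A B -> hom A C;
  compc1 : forall A B (f : hom A B), compc f (idc A) = f;
  comp1c : forall A B (f : hom A B), compc (idc B) f = f;
  compcA : forall A B C D (h : hom C D) (g : hom B C) (f : hom A B),
    compc h (compc g f) = compc (compc h g) f }.

Arguments hom {c} A B.
Arguments idc {c} A.
Arguments compc {c A B C} g f.

Record functor (C D : category) := Functor {
  fobj :> C -> D;
  fmap : forall A B, hom A B -> hom (fobj A) (fobj B);
  fmap1 : forall A, fmap (idc A) = idc (fobj A);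
  fmapM : forall A B E (g : hom B E) (f : hom A B),
    fmap (compc g f) = compc (fmap g) (fmap f) }.

Arguments fmap {C D} _ {A B} _.

Record cocone (C : category) (I : Type) (A : I -> C) := Cocone {
  apex : C;
  leg : forall i, hom (A i) apex }.

Arguments apex {C I A} c.
Arguments leg {C I A} c i.

Definition is_coproduct (C : category) (I : Type) (A : I -> C)
    (c : cocone A) : Prop :=
  forall d : cocone A,
    exists! h : hom (apex c) (apex d), forall i, compc h (leg c i) = leg d i.

Definition map_cocone (C D : category) (F : functor C D) (I : Type)
    (A : I -> C) (c : cocone A) : cocone (fun i => F (A i)) :=
  Cocone (fun i => fmap F (leg c i)).

(* The equation [map_cocone F c = b] is an equality of dependent pairs: it says
   that the apex of [c] is sent to the apex of [b] on the nose, and that, along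
   this identification, the legs of [c] are sent to those of [b]. Uniqueness of
   [c] accordingly bears on its apex as well as on its legs. *)
Definition creates_coproducts (C D : category) (F : functor C D) : Prop :=
  forall (I : Type) (A : I -> C) (b : cocone (fun i => F (A i))),
    is_coproduct b ->
    exists c : cocone A,
      unique (fun c' : cocone A => map_cocone F c' = b) c /\ is_coproduct c.

HB.mixin Record isTopologicalGroup G & Topological G & Group G := {
  mulg_continuous : continuous (fun p : G * G => (p.1 * p.2)%g);
  invg_continuous : continuous (fun g : G => (g^-1)%g) }.

#[short(type="topologicalGroupType")]
HB.structure Definition TopologicalGroup :=
  { G of Topological G & Group G & isTopologicalGroup G }.

(* The property required of [discreteTopologicalType], as a predicate. *)
Definition discrete_space (T : topologicalType) : Prop :=
  @nbhs T T = @principal_filter T.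

Record compact_hausdorff := CompactHausdorff {
  ch_space :> topologicalType;
  ch_compact : compact [set: ch_space];
  ch_hausdorff : hausdorff_space ch_space }.

Section compact_hausdorff_category.

Let comp (X Y Z : compact_hausdorff) (g : continuousType Y Z)
  (f : continuousType X Y) : continuousType X Z := g \o f.

Let one (X : compact_hausdorff) : continuousType X X := idfun.

Fact ch_comp1 (X Y : compact_hausdorff) (f : continuousType X Y) : comp f (one X) = f.
Proof. exact/continuousEP. Qed.

Fact ch_1comp (X Y : compact_hausdorff) (f : continuousType X Y) : comp (one Y) f = f.
Proof. exact/continuousEP. Qed.

Fact ch_compA (X Y Z W : compact_hausdorff) (h : continuousType Z W) (g : continuousType Y Z)
  (f : continuousType X Y) : comp h (comp g f) = comp (comp h g) f.
Proof. exact/continuousEP. Qed.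

Definition CH : category :=
  Category (hom := fun X Y : compact_hausdorff => continuousType X Y)
    ch_comp1 ch_1comp ch_compA.

End compact_hausdorff_category.

Section equivariant_category.
Variable G : topologicalGroupType.

Record compact_hausdorff_action := CompactHausdorffAction {
  ga_space :> compact_hausdorff;
  ga_act : G -> ga_space -> ga_space;
  ga_act1 : forall x, ga_act 1%g x = x;
  ga_actM : forall g h x, ga_act (g * h)%g x = ga_act g (ga_act h x);
  ga_act_continuous :
    continuous (fun p : G * ga_space => ga_act p.1 p.2) }.

Record equivariant_map (X Y : compact_hausdorff_action) := EquivariantMap {
  eq_map :> continuousType X Y;
  eq_mapE : forall g x, eq_map (ga_act g x) = ga_act g (eq_map x) }.

Lemma equivariant_mapEP (X Y : compact_hausdorff_action)
  (f g : equivariant_map X Y) : eq_map f = eq_map g -> f = g.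
Proof.
case: f g => [f fE] [g gE] /= fg; rewrite fg in fE *.
by congr EquivariantMap; exact: Prop_irrelevance.
Qed.

Fact equivariant_compE (X Y Z : compact_hausdorff_action)
    (u : equivariant_map Y Z) (v : equivariant_map X Y) g x :
  (compc (c := CH) u v : continuousType X Z) (ga_act g x) =
  ga_act g ((compc (c := CH) u v : continuousType X Z) x).
Proof. by rewrite /= !eq_mapE. Qed.

Let comp (X Y Z : compact_hausdorff_action)
    (u : equivariant_map Y Z) (v : equivariant_map X Y) :
    equivariant_map X Z :=
  EquivariantMap (equivariant_compE u v).

Let one (X : compact_hausdorff_action) : equivariant_map X X :=
  @EquivariantMap X X (idc (c := CH) X) (fun g x => erefl).

Fact ga_comp1 X Y (f : equivariant_map X Y) : comp f (one X) = f.
Proof. exact/equivariant_mapEP/(@compc1 CH). Qed.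

Fact ga_1comp X Y (f : equivariant_map X Y) : comp (one Y) f = f.
Proof. exact/equivariant_mapEP/(@comp1c CH). Qed.

Fact ga_compA X Y Z W (h : equivariant_map Z W) (g : equivariant_map Y Z)
  (f : equivariant_map X Y) : comp h (comp g f) = comp (comp h g) f.
Proof. exact/equivariant_mapEP/(@compcA CH). Qed.

Definition CHact : category := Category ga_comp1 ga_1comp ga_compA.

Definition forget : functor CHact CH :=
  @Functor CHact CH ga_space eq_map (fun=> erefl) (fun _ _ _ _ _ => erefl).

End equivariant_category.

(* Main.v *)
Require Import Defs.
From HB Require Import structures.
From mathcomp Require Import all_boot all_order all_algebra all_classical reals.
From mathcomp Require Import Rstruct topology normedtype.

(* If G is discrete, the universal property of a coproduct of the underlying
   spaces provides, for each g, a unique continuous self-map extending the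
   action of g on the summands; these maps form the only compatible action, and
   it is jointly continuous because G is discrete.

   Conversely, let G act by translation on its one-point compactification X,
   and consider the coproduct B of G copies of X, a Stone-Cech
   compactification, with injections j_g. For g <> 1, choose a Urysohn
   function phi_g on X with phi_g(1) = 0 and phi_g(g) = 1; together these
   induce a map u on B. If B carries a jointly continuous compatible action and
   1 is not isolated, the points j_g(1) have a cluster point b as g tends to 1,
   with u(1 b) = u(b) = 0, whereas u(g j_g(1)) = phi_g(g) = 1, contradicting
   continuity of (g, y) |-> u(g y) at (1, b). *)

Set Implicit Arguments.
Unset Strict Implicit.
Unset Printing Implicit Defensive.
Import Order.TTheory GRing.Theory Num.Theory.
Import numFieldTopology.Exports.
(* [hom], [fmap] and [eq_map] also name unrelated library constants. *)
Import Defs.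

Local Open Scope classical_set_scope.

(** * Morphisms out of a coproduct and equality of cocones *)

Lemma coproduct_hom_ext (C : category) (I : Type) (A : I -> C) (c : cocone A)
    (X : C) (h k : hom (apex c) X) :
  is_coproduct c ->
  (forall i, compc h (leg c i) = compc k (leg c i)) -> h = k.
Proof.
move=> cP hk.
have [l [_ lP]] := cP (Cocone (fun i => compc h (leg c i))).
by rewrite -(lP h)// -(lP k).
Qed.

(** The legs are transported along an arbitrary proof that the apex is [X]. Once the cocones are
    identified, this proof is a loop at [X], trivial by proof irrelevance. *)
Lemma cocone_eqP (C : category) (I : Type) (A : I -> C) (X : C)
    (l l' : forall i, hom (A i) X) :
  Cocone l = Cocone l' -> l = l'.
Proof.
pose legs (c : cocone A) (e : apex c = X) i : hom (A i) X :=
  eq_rect _ (fun Y => hom (A i) Y) (leg c i) _ e.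
move=> ll'; have H c (e : apex c = X) : c = Cocone l' -> legs c e = l'.
  by move=> cl'; subst c; rewrite (Prop_irrelevance e erefl).
exact: (H (Cocone l) erefl).
Qed.

(** * Coproducts of spaces with an action; the discrete case *)

Section forget.
Context {G : topologicalGroupType}.

Lemma act_continuous (X : compact_hausdorff_action G) (g : G) :
  continuous (fun x : X => ga_act g x).
Proof.
move=> x; apply: (@continuous_comp _ _ _ (pair g)
  (fun p : G * X => ga_act p.1 p.2)); last exact: ga_act_continuous.
by apply: cvg_pair; [exact: cvg_cst|exact: cvg_id].
Qed.

Definition act_hom (X : compact_hausdorff_action G) (g : G) :
  hom (c := CH) X X := mkcts (@act_continuous X g).

(** The map induced on the underlying spaces is equivariant: its composites with the actions of [g]
    on either side agree on the legs. *)
Lemma forget_reflects_coproducts (I : Type) (A : I -> CHact G) (c : cocone A) :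
  is_coproduct (map_cocone (forget G) c) -> is_coproduct c.
Proof.
move=> cP d; have [h [hE hU]] := cP (map_cocone (forget G) d).
have h_eqv g x : (h : continuousType _ _) (ga_act g x) =
    ga_act g ((h : continuousType _ _) x).
  suff /(congr1 (fun k : continuousType _ _ => k x)) :
    compc h (act_hom (apex c) g) = compc (act_hom (apex d) g) h by [].
  apply: (coproduct_hom_ext cP) => i; apply/continuousEP => y /=.
  have hl z : (h : continuousType _ _) (eq_map (leg c i) z) =
      eq_map (leg d i) z.
    exact: (congr1 (fun k : continuousType _ _ => k z) (hE i)).
  by rewrite /= /mkcts -!eq_mapE !hl eq_mapE.
exists (EquivariantMap h_eqv); split=> [i|k kE].
  exact/equivariant_mapEP/hE.
apply/equivariant_mapEP/hU => i.
exact: (congr1 (@fmap _ _ (forget G) (A i) (apex d)) (kE i)).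
Qed.

(** Both actions of [g] agree on the images of the legs, hence everywhere by uniqueness of maps out
    of the coproduct. The remaining fields are propositions. *)
Lemma forget_cocone_inj (I : Type) (A : I -> CHact G) (c c' : cocone A) :
  is_coproduct (map_cocone (forget G) c) ->
  map_cocone (forget G) c = map_cocone (forget G) c' -> c = c'.
Proof.
case: c c' => [[B act act1 actM act_cts] l] [[B' act' act1' actM' act_cts'] l'].
move=> cP cc'; have /= BB' := congr1 apex cc'; subst B'.
have ll' := cocone_eqP cc'.
have actE : act = act'.
  apply/funext => g; apply/funext => x.
  pose X := CompactHausdorffAction act1 actM act_cts.
  pose X' := CompactHausdorffAction act1' actM' act_cts'.
  suff /(congr1 (fun k : continuousType _ _ => k x)) :
    act_hom X g = act_hom X' g by [].
  apply: (coproduct_hom_ext cP) => i; apply/continuousEP => y /=.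
  have l'E z : eq_map (l i) z = eq_map (l' i) z :> B.
    exact: (congr1 (fun k : forall i, continuousType (A i) B => k i z) ll').
  transitivity (eq_map (l i) (ga_act g y) : B); first by rewrite eq_mapE.
  rewrite l'E [LHS](eq_mapE (l' i)).
  by rewrite /= l'E.
subst act'.
have ? := Prop_irrelevance act1 act1'; subst act1'.
have ? := Prop_irrelevance actM actM'; subst actM'.
have ? := Prop_irrelevance act_cts act_cts'; subst act_cts'.
congr Cocone; apply: functional_extensionality_dep => i.
exact/equivariant_mapEP/(congr1 (fun k => k i) ll').
Qed.

Lemma discrete_creates_coproducts :
  discrete_space G -> creates_coproducts (forget G).
Proof.
move=> Gdiscrete I A [B l] bP.
have /choice[a aE] : forall g, exists h : hom (c := CH) B B,
    forall i, compc h (l i) = compc (l i) (act_hom (A i) g).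
  move=> g; have [h [hE _]] :=
    bP (Cocone (fun i => compc (l i) (act_hom (A i) g))).
  by exists h.
have alE g i x : (a g : continuousType _ _) ((l i : continuousType _ _) x) =
    (l i : continuousType _ _) (ga_act g x).
  exact: (congr1 (fun k : continuousType _ _ => k x) (aE g i)).
pose act g (x : B) : B := (a g : continuousType _ _) x.
have act1 x : act 1%g x = x.
  suff /(congr1 (fun k : continuousType _ _ => k x)) :
    a 1%g = idc (c := CH) B by [].
  apply: (coproduct_hom_ext bP) => i; apply/continuousEP => y /=.
  by rewrite alE ga_act1.
have actM g h x : act (g * h)%g x = act g (act h x).
  suff /(congr1 (fun k : continuousType _ _ => k x)) :
    a (g * h)%g = compc (a g) (a h) by [].
  apply: (coproduct_hom_ext bP) => i; apply/continuousEP => y /=.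
  by rewrite !alE ga_actM.
have act_cts : continuous (fun p : G * B => act p.1 p.2).
  (* By discreteness [[set g]] is a neighbourhood of [g], which leaves only the continuity of the
     single map [a g]. *)
  move=> [g x] U /= Ugx; exists ([set g], act g @^-1` U) => /=.
    by split; [rewrite Gdiscrete|exact: (@cts_fun _ _ (a g))].
  by move=> [h y] /= [-> ].
pose X := CompactHausdorffAction act1 actM act_cts.
have l_eqv i g x : (l i : continuousType (A i) X) (ga_act g x) =
    ga_act g ((l i : continuousType (A i) X) x) by rewrite -alE.
pose c : cocone A :=
  @Cocone (CHact G) I A X (fun i => EquivariantMap (l_eqv i)).
have cE : map_cocone (forget G) c = Cocone l by [].
exists c; split; last by apply: forget_reflects_coproducts; rewrite cE.
by split=> // c' c'E; apply: forget_cocone_inj; rewrite cE.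
Qed.

End forget.

(** * Subspaces and maps into products *)

Lemma compact_set_type (X : topologicalType) (A : set X) :
  compact A -> compact [set: A].
Proof.
move=> Acpt F PF _.
have FA : (set_val @ F) A by apply: (@filterE _ F) => x; exact: set_valP.
have [x [Ax xF]] := Acpt (set_val @ F) _ FA.
exists (SigSub (mem_set Ax)); split => // P Q FP [_ [[O oO <-] Ox] OQ].
have [_ [[p Pp <-] Op]] : set_val @` P `&` O !=set0.
  apply: xF; last exact: open_nbhs_nbhs.
  by apply: (@filterS _ F _ P) FP => p Pp; exists p.
by exists p; split=> //; exact: OQ.
Qed.

Lemma inj_hausdorff (X Y : topologicalType) (f : X -> Y) :
  continuous f -> injective f -> hausdorff_space Y -> hausdorff_space X.
Proof.
move=> fcts finj Yh x y xy; apply/finj/Yh => P Q Px Qy.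
by have [z [Pz Qz]] := xy _ _ (fcts x P Px) (fcts y Q Qy); exists (f z).
Qed.

Lemma hausdorff_set_type (X : topologicalType) (A : set X) :
  hausdorff_space X -> hausdorff_space A.
Proof.
apply: inj_hausdorff; first exact: initial_continuous.
exact: val_inj.
Qed.

Lemma continuous_prod_topology (I : Type) (X : topologicalType)
    (K : I -> topologicalType) (f : X -> prod_topology K) :
  (forall i, continuous (fun x => f x i)) -> continuous f.
Proof.
move=> fcts x; apply/cvg_sup => i U [_ [[O oO <-] Ofx] OU].
apply: filterS OU _; apply: fcts.
exact: open_nbhs_nbhs.
Qed.

(** * Stone-Cech compactification and coproducts of compact Hausdorff spaces *)

Section stone_cech.
Context {R : realType}.
Local Open Scope ring_scope.

Definition unit_fun (Y : topologicalType) : Type :=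
  {phi : Y -> R | continuous phi /\ range phi `<=` `[0, 1]}.

(** The factors are all of [R], so that coordinates are plain reals; the bounds in [unit_fun]
    confine the image of [Y] to a product of unit intervals, compact by Tychonoff. *)
Definition unit_cube (Y : topologicalType) : topologicalType :=
  prod_topology (fun _ : {classic unit_fun Y} => R : topologicalType).

Definition cube_eval (Y : topologicalType) (y : Y) : unit_cube Y :=
  fun phi => sval phi y.

Lemma cube_eval_continuous (Y : topologicalType) : continuous (@cube_eval Y).
Proof. by apply: continuous_prod_topology => -[phi []]. Qed.

Lemma hausdorff_unit_cube (Y : topologicalType) : hausdorff_space (unit_cube Y).
Proof. by apply: hausdorff_product => phi; exact: Rhausdorff. Qed.

Lemma compact_closure_cube_eval (Y : topologicalType) :
  compact (closure (range (@cube_eval Y))).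
Proof.
pose K := [set b : unit_cube Y | forall phi, `[0, 1]%classic (b phi)].
have Kcpt : compact K.
  apply: (@tychonoff {classic unit_fun Y} (fun=> R)
    (fun=> `[0, 1]%classic)) => _.
  exact: segment_compact.
apply: (subclosed_compact (@closed_closure _ _) Kcpt).
have /closure_id -> : closed K.
  by apply: compact_closed => //; exact: hausdorff_unit_cube.
by apply: closureS => _ [y _ <-] phi; apply: (svalP phi).2; exists y.
Qed.

Definition stone_cech (Y : topologicalType) : compact_hausdorff :=
  @CompactHausdorff (closure (range (@cube_eval Y)))
    (compact_set_type (@compact_closure_cube_eval Y))
    (@hausdorff_set_type _ _ (@hausdorff_unit_cube Y)).

Definition stone_cech_unit (Y : topologicalType) (y : Y) : stone_cech Y :=
  SigSub (mem_set (subset_closure (imageT (@cube_eval Y) y))).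

Lemma stone_cech_unit_continuous (Y : topologicalType) :
  continuous (@stone_cech_unit Y).
Proof. apply: continuous_comp_initial; exact: cube_eval_continuous. Qed.

(** The unit has dense image: near any [b] it takes a value where [u] and [v] agree, so no
    neighbourhoods separate [u b] from [v b]. *)
Lemma stone_cech_ext (Y Z : topologicalType) (u v : stone_cech Y -> Z) :
  hausdorff_space Z -> continuous u -> continuous v ->
  u \o @stone_cech_unit Y =1 v \o @stone_cech_unit Y -> u =1 v.
Proof.
move=> Zh ucts vcts uv b; apply: Zh => P Q Pu Qv.
have [_ [[O oO <-] Ob] OPQ] : nbhs b (u @^-1` P `&` v @^-1` Q).
  by apply: filterI; [exact: ucts|exact: vcts].
have [_ [[y _ <-] Oy]] := set_valP b O (open_nbhs_nbhs (conj oO Ob)).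
have [Py Qy] := OPQ (stone_cech_unit y) Oy.
exists (u (stone_cech_unit y)); split => //.
by rewrite [u _]uv.
Qed.

Lemma unit_fun_separates (Z : compact_hausdorff) (C : set Z) (z : Z) :
  closed C -> ~ C z ->
  exists phi : unit_fun Z, sval phi z = 0 /\ forall x, C x -> sval phi x = 1.
Proof.
move=> Ccl Cz.
have Zn := compact_normal (@ch_hausdorff Z) (@ch_compact Z).
have zcl : closed [set z].
  exact/accessible_closed_set1/hausdorff_accessible/ch_hausdorff.
have zC : [set z] `&` C = set0 by rewrite -subset0 => _ [-> /Cz].
have /(uniform_separatorP (R := R))[phi [phic phi01 phiz phiC]] :=
  (@normal_separatorP R _).1 Zn _ _ zcl Ccl zC.
exists (exist _ phi (conj phic phi01)); split=> [|x Cx] /=.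
  by apply: phiz; exists z.
by apply: phiC; exists x.
Qed.

Lemma unit_fun_inj (Z : compact_hausdorff) (z w : Z) :
  (forall phi : unit_fun Z, sval phi z = sval phi w) -> z = w.
Proof.
move=> zw; apply: contrapT => zNw.
have wcl : closed [set w].
  exact/accessible_closed_set1/hausdorff_accessible/ch_hausdorff.
have [phi [phiz phiw]] := unit_fun_separates wcl zNw.
by have /eqP := zw phi; rewrite phiz phiw// eq_sym oner_eq0.
Qed.

(** Precomposition with [f] induces a map [T] between the cubes. It sends the closure of the image
    of [Y] into the image of [Z], which is closed because [Z] is compact, and evaluation is
    injective on [Z]. *)
Lemma stone_cech_lift (Y : topologicalType) (Z : compact_hausdorff)
    (f : Y -> Z) : continuous f ->
  exists2 h : stone_cech Y -> Z,
    continuous h & h \o @stone_cech_unit Y =1 f.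
Proof.
move=> fcts.
have pull_sub (phi : unit_fun Z) : continuous (sval phi \o f) /\
    range (sval phi \o f) `<=` `[0, 1].
  case: phi => phi [phic phi01] /=; split.
    by move=> y; apply: continuous_comp; [exact: fcts|exact: phic].
  by move=> _ [y _ <-]; apply: phi01; exists (f y).
pose pull phi : unit_fun Y := exist _ _ (pull_sub phi).
pose T (b : unit_cube Y) : unit_cube Z := fun phi => b (pull phi).
have Tcts : continuous T.
  apply: continuous_prod_topology => phi.
  exact: (@proj_continuous {classic unit_fun Y} (fun=> R) (pull phi)).
have Zcl : closed (range (@cube_eval Z)).
  apply: compact_closed; first exact: hausdorff_unit_cube.
  apply: continuous_compact; last exact: ch_compact.
  exact/continuous_subspaceT/cube_eval_continuous.
have /choice[h hE] : forall b : stone_cech Y, exists z : Z,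
    forall phi : unit_fun Z, sval phi z = set_val b (pull phi).
  move=> b; suff [z _ zE] : range (@cube_eval Z) (T (set_val b)).
    by exists z => phi; exact: (congr1 (fun c => c phi) zE).
  apply: Zcl => P /Tcts TP.
  have [_ [[y _ <-] Py]] := set_valP b _ TP.
  by exists (T (cube_eval y)); split => //; exists (f y).
exists h; last by move=> y; apply: unit_fun_inj => phi; rewrite hE.
(* Where a function separating [h b] from the complement of [O] stays below 1, [h] takes values in
   [O]; through [hE] this is an open condition on one coordinate. *)
apply/continuousP => O oO; rewrite openE => b Ob.
have [] := @unit_fun_separates Z (~` O) (h b); first exact: open_closedC.
  by move=> /(_ Ob).
move=> phi [phib phiO].
have phi_cts : continuous (fun c : stone_cech Y => set_val c (pull phi)).
  move=> c; apply: (@continuous_comp (stone_cech Y) (unit_cube Y) R set_val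
    (fun d => d (pull phi))).
    exact: initial_continuous.
  exact: (@proj_continuous {classic unit_fun Y} (fun=> R)).
have : nbhs b [set c : stone_cech Y | set_val c (pull phi) < 1].
  apply: (phi_cts b [set r | r < 1]); apply: open_nbhs_nbhs; split.
    exact: open_lt.
  by rewrite /= -hE phib ltr01.
apply: filterS => c /= c1; apply: contrapT => /phiO.
by rewrite hE => c1'; move: c1; rewrite c1' ltxx.
Qed.

Definition unit_interval : compact_hausdorff :=
  @CompactHausdorff `[(0 : R), 1]%classic
    (compact_set_type (@segment_compact R 0 1))
    (@hausdorff_set_type _ _ (@Rhausdorff R)).

Definition unit_fun_corestr (Y : topologicalType) (phi : unit_fun Y) (y : Y) :
  unit_interval := SigSub (mem_set ((svalP phi).2 _ (imageT (sval phi) y))).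

Lemma unit_fun_corestr_continuous (Y : topologicalType) (phi : unit_fun Y) :
  continuous (unit_fun_corestr phi).
Proof. by apply: continuous_comp_initial; exact: (svalP phi).1. Qed.

(** The coproduct is the Stone-Cech compactification of the topological sum: the legs of a cocone
    glue to a continuous map on the sum, which extends uniquely. *)
Lemma CH_coproduct (I : choiceType) (A : I -> CH) :
  exists b : cocone A, is_coproduct b.
Proof.
pose Y : topologicalType := {i & (A i : compact_hausdorff)}.
have in_cts i : continuous (@stone_cech_unit Y \o
    existT (fun i => A i : compact_hausdorff) i).
  move=> x; apply: continuous_comp; first exact: existT_continuous.
  exact: stone_cech_unit_continuous.
exists (@Cocone CH I A (stone_cech Y) (fun i => mkcts (in_cts i))) => -[Z l].
pose f (p : Y) : Z := (l (projT1 p) : continuousType _ _) (projT2 p).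
have fcts : continuous f.
  by move=> [i x]; exact: (@cts_fun _ _ (l i) x).
have [h hcts hE] := stone_cech_lift fcts.
exists (mkcts hcts : continuousType (stone_cech Y) Z); split=> [i|k kE].
  by apply/continuousEP => x; rewrite /= /mkcts/= [LHS]hE.
apply/continuousEP; apply: stone_cech_ext => //; first exact: ch_hausdorff.
  exact: (@cts_fun _ _ k).
move=> [i x]; rewrite hE.
exact: esym (congr1 (fun m : continuousType _ _ => m x) (kE i)).
Qed.

End stone_cech.

(** * Translation on the one-point compactification; the converse *)

Section translation_action.
Context {G : topologicalGroupType}.
Context (Ghausdorff : hausdorff_space G).
Context (Glocally_compact : locally_compact [set: G]).

Definition opc_act (g : G) (x : one_point_compactification G) :
  one_point_compactification G := omap (fun h => (g * h)%g) x.

Lemma opc_act1 x : opc_act 1%g x = x.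
Proof. by case: x => [x|//]; rewrite /opc_act/= mul1g. Qed.

Lemma opc_actM g h x : opc_act (g * h)%g x = opc_act g (opc_act h x).
Proof. by case: x => [x|//]; rewrite /opc_act/= mulgA. Qed.

(** At a point of [G] this is continuity of multiplication. At infinity, a compact neighbourhood of
    [g] allows one compact set to be excluded for all nearby group elements at once. *)
Lemma opc_act_continuous :
  continuous (fun p : G * one_point_compactification G => opc_act p.1 p.2).
Proof.
move=> [g [x|]] U /= nU.
  have [[P Q] /= [gP xQ] PQU] := @mulg_continuous G (g, x) _ nU.
  exists (P, Some @` Q) => /=.
    by split=> //; exact: one_point_compactification_some_nbhs.
  by move=> [h _] /= [Ph [y Qy <-]]; exact: (PQU (h, y)).
have [C [Ccpt Ccl] CU] := nU.
have [V] := @Glocally_compact g I; rewrite withinET => gV [Vcpt Vcl].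
(* Elements of [V] move no point outside the compact set [V^-1 * C] into [C]. *)
pose m (p : G * G) := (p.1^-1 * p.2)%g.
have mcts : continuous m.
  move=> p; apply: (@continuous_comp _ _ _ (fun p : G * G => (p.1^-1, p.2)%g)
    (fun p => p.1 * p.2)%g); last exact: mulg_continuous.
  apply: cvg_pair; last exact: cvg_snd.
  apply: (@continuous_comp _ _ _ fst (fun g : G => g^-1%g)).
    exact: cvg_fst.
  exact: invg_continuous.
have Kcpt : compact (m @` (V `*` C)).
  apply: continuous_compact; last exact: compact_setX.
  exact/continuous_subspaceT.
exists (V, (Some @` (~` (m @` (V `*` C)))) `|` [set None]) => /=.
  split=> //; exists (m @` (V `*` C)) => //.
  by split=> //; exact: compact_closed.
move=> [h y] /= [Vh [[x xK <-]|->]]; apply: CU; last by right.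
left; exists (h * x)%g => // Chx; apply: xK; exists (h, h * x)%g => //.
by rewrite /m /= mulgA mulVg mul1g.
Qed.

Definition opc_action : compact_hausdorff_action G :=
  @CompactHausdorffAction G
    (CompactHausdorff one_point_compactification_compact
      (one_point_compactification_hausdorff Glocally_compact Ghausdorff))
    opc_act opc_act1 opc_actM opc_act_continuous.

Lemma nbhs1_discrete : nbhs (1%g : G) [set 1%g] -> discrete_space G.
Proof.
move=> n1; apply/funext => g; apply/seteqP; split=> U.
  by move=> /nbhs_singleton Ug _ ->.
move=> Ug.
have cts : continuous (fun h : G => g^-1 * h)%g.
  move=> h; apply: (@continuous_comp _ _ _ (pair g^-1%g)
    (fun p : G * G => p.1 * p.2)%g); last exact: mulg_continuous.
  by apply: cvg_pair; [exact: cvg_cst|exact: cvg_id].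
have : nbhs g [set h | g^-1 * h = 1]%g.
  by apply: (cts g [set 1%g]); rewrite /= mulVg.
apply: filterS => h /= gh.
suff -> : h = g by exact: Ug.
by rewrite -[h]mul1g -(mulgV g) -mulgA gh mulg1.
Qed.

Lemma creates_coproducts_discrete :
  creates_coproducts (forget G) -> discrete_space G.
Proof.
move=> create; apply: nbhs1_discrete; apply: contrapT => n1.
(* The statement involves no real numbers, so a concrete model is fixed. *)
pose R : realType := Rdefinitions.R.
pose X := opc_action.
have [b bP] := @CH_coproduct R G (fun _ => ga_space X).
have [c [[cE _] _]] := create G (fun _ => X) b bP.
(* Eliminating [b] makes the space underlying [apex c] the coproduct itself, with no transport along
   [cE]. *)
move: bP; rewrite -{}cE => {b} cP.
have /choice[phi phiE] : forall g : G, exists phi : unit_fun (R := R) X,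
    sval phi (Some 1%g : X) = 0%R /\
    (g <> 1%g -> sval phi (Some g : X) = 1%R).
  move=> g; have [->|/eqP g1] := eqVneq g 1%g.
    (* For [g = 1] only the value 0 at 1 is required, so the closed set is taken empty. *)
    have [|//|phi [phi1 _]] := @unit_fun_separates R X set0 (Some 1%g : X).
      exact: closed0.
    by exists phi.
  have [||phi [phi1 phig]] :=
      @unit_fun_separates R X [set (Some g : X)] (Some 1%g : X).
  - exact/accessible_closed_set1/hausdorff_accessible/ch_hausdorff.
  - by move=> [/esym].
  - by exists phi; split=> // _; exact: phig.
have phi_cts g : continuous (unit_fun_corestr (phi g)).
  exact: unit_fun_corestr_continuous.
have [h [hE _]] := cP (@Cocone CH G (fun _ => ga_space X)
  (unit_interval (R := R)) (fun g => mkcts (phi_cts g))).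
pose B : compact_hausdorff_action G := apex c.
pose j g (x : X) : B := eq_map (leg c g) x.
pose u (y : B) : R := set_val ((h : continuousType B unit_interval) y).
have uj g x : u (j g x) = sval (phi g) x.
  exact: (congr1 (fun m : continuousType X unit_interval => set_val (m x))
    (hE g)).
have ucts : continuous u.
  move=> y; apply: (@continuous_comp B (unit_interval (R := R)) R h set_val).
    exact: (@cts_fun _ _ h).
  exact: initial_continuous.
(* The punctured neighbourhood filter of 1 is proper because 1 is not isolated; its use provides
   [g <> 1] below. *)
pose F : set_system B := (fun g => j g (Some 1%g)) @ 1%g^'.
have F_proper : ProperFilter F.
  apply: fmap_proper_filter; split; last exact: dnbhs_filter.
  move=> n0; apply: n1.
  have : nbhs (1%g : G) [set g | g != 1%g -> False] := n0.
  by apply: filterS => g gN1; apply: contrapT => /eqP.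
have [b [_ bF]] := @ch_compact B F F_proper filterT.
have ub : u b = 0%R.
  have ucl : closed (u @^-1` [set 0%R]).
    apply: preimage_closed => [y _|]; first exact: ucts.
    exact/accessible_closed_set1/hausdorff_accessible/Rhausdorff.
  apply: ucl; move: bF; rewrite clusterE; apply.
  by apply: (@filterE _ 1%g^') => g; exact: etrans (uj g _) (phiE g).1.
have [[V W] /= [V1 Wb] VWu] :
    nbhs (1%g, b) [set p : G * B | u (ga_act p.1 p.2) < 1]%R.
  have : {for (1%g, b), continuous (fun p : G * B => u (ga_act p.1 p.2))}.
    apply: (@continuous_comp _ _ _ (fun p : G * B => ga_act p.1 p.2) u).
      exact: ga_act_continuous.
    exact: ucts.
  move=> /(_ [set r | (r < 1)%R]); apply; apply: open_nbhs_nbhs; split.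
    exact: open_lt.
  by rewrite /= ga_act1 ub ltr01.
have [_ [[g [Vg g1] <-] Wg]] :
    ((fun g => j g (Some 1%g)) @` (V `&` ~` [set 1%g])) `&` W !=set0.
  apply: bF => //; have V1' : 1%g^' (V `&` ~` [set 1%g]).
    have : nbhs (1%g : G) [set g | g != 1%g -> (V `&` ~` [set 1%g]) g].
      by apply: filterS V1 => g Vg /eqP.
    by [].
  by apply: filterS V1' => g Vg; exists g.
have := VWu (g, j g (Some 1%g)) (conj Vg Wg); rewrite /=.
(* Equivariance of the leg moves [g] inside, giving [phi g] at [g], that is 1, against the bound
   [< 1]. *)
rewrite -[ga_act _ _](eq_mapE (leg c g)) [u _]uj /= mulg1 (phiE g).2//.
by rewrite ltxx.
Qed.

End translation_action.

Theorem theoremC (G : topologicalGroupType)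
    (Ghausdorff : hausdorff_space G)
    (Glocally_compact : locally_compact [set: G]) :
  discrete_space G <-> creates_coproducts (forget G).
Proof.
split; first exact: discrete_creates_coproducts.
exact: creates_coproducts_discrete.
Qed.
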